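(* (In ZFC.) There exists a regular separable sequentially compact space $S$ which is not functionally Hausdorff.
   Context: Regular spaces are assumed to be $T_1$. A space $S$ is functionally Hausdorff if for any two distinct points $a,b\in S$ there is a continuous function $f:S\to\mathbb{R}$ with $f(a)\neq f(b)$. A space is sequentially compact if every sequence in it has a convergent subsequence. *)

(* Defs.v *)
From mathcomp Require Import all_boot all_order all_algebra.
From mathcomp Require Import all_classical all_reals all_analysis.

Set Implicit Arguments.
Unset Strict Implicit.
Unset Printing Implicit Defensive.

Import numFieldNormedType.Exports.

Local Open Scope classical_set_scope.

(* mathcomp-analysis' [regular_space] does not include T1. *)
Definition regular_T1_space (T : topologicalType) : Prop :=
  accessible_space T /\ regular_space T.

Definition separable_space (T : topologicalType) : Prop :=
  exists2 D : set T, countable D & dense D.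

(* [increasing_seq] means strictly increasing.  The limit is quantified
   explicitly because [cvg] requires a pointed type. *)
Definition sequentially_compact_space (T : topologicalType) : Prop :=
  forall u : nat -> T, exists2 f : nat -> nat,
    increasing_seq f & exists l : T, (u \o f) n @[n --> \oo] --> l.

Definition functionally_hausdorff_space (R : realType) (T : topologicalType)
    : Prop :=
  forall a b : T, a <> b ->
    exists2 f : T -> R, continuous f & f a <> f b.

(* Main.v *)
(* Let T be a maximal tower: a family of infinite coinfinite sets of naturals,
   well-ordered by strict inclusion modulo finite sets, such that every infinite set
   meets some T_a in an infinite set.  The length W of T has uncountable cofinality,
   and Y = nat + W is separable and sequentially compact for the topology generated
   by the sets T_a together with all b <= a, their complements, and the singletons
   of natural numbers.  Let Z be Y with a point at infinity, the limit of W.  On the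
   plank Z x Z minus its corner a continuous real function takes the same value at
   some pair of corresponding points of the two edges {infinity} x Y and
   Y x {infinity}, because at arbitrarily large c both values equal the one at
   (c, c).  Glue planks indexed by the integers in a chain along these edges, and add
   one point at each end of the chain: the value of a continuous function is then the
   same on infinitely many edges in both directions, hence at the two ends. *)

Require Import Defs.
From HB Require Import structures.
From mathcomp Require Import all_boot all_order all_algebra.
From mathcomp Require Import all_classical all_reals all_analysis.
From mathcomp Require Import zify.

Set Implicit Arguments.
Unset Strict Implicit.
Unset Printing Implicit Defensive.

Import Order.TTheory GRing.Theory Num.Theory.
Import numFieldNormedType.Exports.

Local Open Scope classical_set_scope.

(** * Infinite sets of naturals and subsequences *)

Definition frequently (A : set nat) : Prop := ~ \forall k \near \oo, ~ A k.

Lemma frequentlyP (A : set nat) :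
  frequently A <-> forall n, exists2 m, (n <= m)%N & A m.
Proof.
split=> [fA n|hA [N _ hN]].
  apply: contrapT => h; apply: fA; exists n => // m /= nm Am.
  by apply: h; exists m.
by have [m Nm Am] := hA N; exact: (hN m).
Qed.

Lemma frequently_sub (A B : set nat) :
  (\forall k \near \oo, A k -> B k) -> frequently A -> frequently B.
Proof.
move=> AB fA fB; apply: fA; near=> k => Ak.
by have : ~ B k; [near: k|apply; move: Ak; near: k].
Unshelve. all: by end_near. Qed.

Lemma frequently_ex (A : set nat) : frequently A -> exists k, A k.
Proof. by move=> /frequentlyP/(_ 0%N)[k _ Ak]; exists k. Qed.

Lemma frequently_split (A B : set nat) :
  frequently A -> frequently (A `&` B) \/ frequently (A `\` B).
Proof.
move=> fA; apply: contrapT => /not_orP[/contrapT h1 /contrapT h2].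
apply: fA; near=> k => Ak; have [Bk|nBk] := pselect (B k).
  by have : ~ (A `&` B) k; [near: k|apply].
by have : ~ (A `\` B) k; [near: k|apply].
Unshelve. all: by end_near. Qed.

Lemma increasing_seq_ge (f : nat -> nat) (i : nat) :
  increasing_seq f -> (i <= f i)%N.
Proof.
move=> fi; elim: i => // i IH; apply: leq_ltn_trans IH _.
by rewrite ltnNge; have := fi i.+1 i; rewrite leEnat => ->; rewrite ltnn.
Qed.

Lemma near_subseq (f : nat -> nat) (P : set nat) : increasing_seq f ->
  (\forall k \near \oo, P k) -> \forall i \near \oo, P (f i).
Proof.
move=> fi [N _ hN]; exists N => // i /= Ni.
exact: (hN _ (leq_trans Ni (increasing_seq_ge i fi))).
Qed.

Lemma increasing_seq_comp (f g : nat -> nat) :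
  increasing_seq f -> increasing_seq g -> increasing_seq (f \o g).
Proof. by move=> fi gi m n; rewrite /= fi -leEnat gi. Qed.

Lemma frequently_subseq (A : set nat) : frequently A ->
  exists2 f : nat -> nat, increasing_seq f & forall i, A (f i).
Proof.
move=> /frequentlyP fA.
have /choice[g hg] : forall n, exists m, (n <= m)%N /\ A m.
  by move=> n; have [m nm Am] := fA n; exists m.
pose f i := iter i (fun m => g m.+1) (g 0).
have fA' i : A (f i) by case: i => [|i]; [exact: (hg 0).2|exact: (hg _).2].
exists f => //; apply/increasing_seqP => i.
by rewrite ltEnat /=; exact: (hg _).1.
Qed.

(** * Maximal towers *)

Definition almost_lt (A B : set nat) : Prop :=
  (\forall k \near \oo, A k -> B k) /\ frequently (B `\` A).

Lemma almost_lt_asym (A B : set nat) : almost_lt A B ->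
  ~ \forall k \near \oo, B k -> A k.
Proof.
by move=> [_ fBA] BA; apply: fBA; apply: filterS BA => k BA [/BA].
Qed.

Lemma almost_lt_irr (A : set nat) : ~ almost_lt A A.
Proof. by move=> h; apply: (almost_lt_asym h); exact: nearW. Qed.

(** The single clause [tower_least] encodes the whole well-order: on a two-element set it yields
    comparability. *)
Record maximal_tower (W : Type) (T : W -> set nat) : Prop := MaximalTower {
  tower_frequently : forall a, frequently (T a);
  tower_cofrequently : forall a, frequently (~` T a);
  tower_least : forall X : set W, X !=set0 ->
    exists2 m, X m & forall x, X x -> x <> m -> almost_lt (T m) (T x);
  tower_maximal : forall A, frequently A ->
    exists a, frequently (A `&` T a) }.

Arguments tower_frequently {W T} _ a.
Arguments tower_cofrequently {W T} _ a.

Section TowerExistence.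

Let tower_family (C : set (set nat)) : Prop :=
  [/\ forall A, C A -> frequently A /\ frequently (~` A)
    & forall X : set (set nat), X `<=` C -> X !=set0 ->
        exists2 M, X M & forall A, X A -> A <> M -> almost_lt M A].

(** Zorn's lemma is applied to end-extension and not to inclusion: an element least in one member of
    a chain stays least in the union, since all elements added later lie above. *)
Let end_ext (C D : set (set nat)) : Prop :=
  C `<=` D /\ forall A B, C A -> D B -> ~ C B -> almost_lt A B.

Let tower_family_bigcup (F : set (set (set nat))) :
  (forall C, F C -> tower_family C) ->
  (forall C D, F C -> F D -> end_ext C D \/ end_ext D C) ->
  tower_family (\bigcup_(C in F) C)
  /\ forall C, F C -> end_ext C (\bigcup_(C in F) C).
Proof.
move=> Ft Fc; split; last first.
  move=> C FC; split; first exact: bigcup_sup.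
  move=> A B CA [D FD DB] nCB.
  by have [[CD h]|[DC _]] := Fc _ _ FC FD; [exact: h|case: nCB; exact: DC].
split=> [A [C FC CA]|X XF [A XA]]; first exact: (Ft _ FC).1.
have [C FC CA] := XF _ XA.
have [|M [XM CM] hM] := (Ft _ FC).2 (X `&` C) (@subIsetr _ _ _).
  by exists A.
exists M => // B XB BM; have [D FD DB] := XF _ XB.
have [CB|nCB] := pselect (C B); first exact: hM.
by have [[_ h]|[DC _]] := Fc _ _ FC FD; [exact: h|case: nCB; exact: DC].
Qed.

(** An [A] almost disjoint from every member allows a new top: [A] splits into infinite halves [E]
    and [O], and the complement of [E] almost contains every member, strictly because of [O]. *)
Let tower_family_extend (C : set (set nat)) (A : set nat) :
  tower_family C -> frequently A ->
  (forall B, C B -> ~ frequently (A `&` B)) ->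
  exists2 D, tower_family D & end_ext C D /\ ~ D `<=` C.
Proof.
move=> [Cf Cl] fA CA.
have [f fi fA'] := frequently_subseq fA.
(* The complement of half of [A] almost contains every member of [C]. *)
pose E : set nat := [set k | exists i, k = f i.*2].
pose O : set nat := [set k | exists i, k = f i.*2.+1].
have finj i j : f i = f j -> i = j.
  by move=> fij; apply/eqP; rewrite eqn_leq -(fi i j) -(fi j i) fij lexx.
have EA : E `<=` A by move=> _ [i ->].
have OA : O `<=` A by move=> _ [i ->].
have OE : O `<=` ~` E.
  by move=> _ [i ->] [j /finj] /(congr1 odd); rewrite /= !odd_double.
have fE : frequently E.
  apply/frequentlyP => n; exists (f n.*2); last by exists n.
  by apply: leq_trans (increasing_seq_ge _ fi); rewrite -addnn leq_addr.
have fO : frequently O.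
  apply/frequentlyP => n; exists (f n.*2.+1); last by exists n.
  by apply: leq_trans (increasing_seq_ge _ fi); rewrite -addnn leqW// leq_addr.
have lt B : C B -> almost_lt B (~` E).
  move=> /CA/contrapT nAB; split.
    by apply: filterS nAB => k + Bk Ek; apply; split=> //; exact: EA.
  apply: frequently_sub fO; apply: filterS nAB => k nAB Ok.
  by split; [exact: OE|move=> Bk; apply: nAB; split=> //; exact: OA].
have nCE : ~ C (~` E) by move=> /lt/almost_lt_irr.
exists (C `|` [set ~` E]); last first.
  split; last by move=> h; apply: nCE; apply: h; right.
  split; first exact: subsetUl.
  by move=> B _ CB [//|-> _]; exact: lt.
split=> [B [/Cf//|->]|X XC [B XB]].
  by rewrite setCK; split=> //; apply: frequently_sub fO; exact: nearW.
have [[M [XM CM]]|nXC] := pselect (X `&` C !=set0).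
  have [|{XM CM}M [XM CM] hM] := Cl (X `&` C) (@subIsetr _ _ _); first by exists M.
  exists M => // B' XB' B'M; have [CB'|->] := XC _ XB'; first exact: hM.
  exact: lt.
have XE B' : X B' -> B' = ~` E.
  by move=> XB'; have [CB'|//] := XC _ XB'; case: nXC; exists B'.
by exists B => // B' /XE ->; rewrite (XE _ XB).
Qed.

(** A family without proper end-extension is maximal, and it is indexed by its own members. *)
Lemma maximal_tower_exists :
  exists (W : Type) (T : W -> set nat), maximal_tower T.
Proof.
pose tf := {C | tower_family C}.
pose R (C D : tf) : bool := `[< end_ext (sval C) (sval D) >].
have [C maxC] : exists C : tf, forall D, R C D -> D = C.
  apply: (@Zorn _ R).
  - by move=> C; apply/asboolP; split.
  - move=> C D E /asboolP[CD hCD] /asboolP[DE hDE]; apply/asboolP; split.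
      exact: subset_trans DE.
    move=> A B CA EB nCB; have [DB|nDB] := pselect (sval D B).
      exact: hCD.
    by apply: hDE => //; exact: CD.
  - move=> [C tC] [D tD] /asboolP[/= CD _] /asboolP[/= DC _].
    by apply: eq_exist; apply/seteqP; split.
  - move=> F Fc; pose F' := [set sval C | C in F].
    have [||tU Uext] := @tower_family_bigcup F'.
    + by move=> _ [[C tC] _ <-].
    + move=> _ _ [C FC <-] [D FD <-].
      by have [/asboolP|/asboolP] := Fc _ _ FC FD; [left|right].
    + exists (exist _ _ tU) => C FC; apply/asboolP; apply: Uext.
      by exists C.
have [Cf Cl] := svalP C.
exists {A | sval C A}, sval; split.
- by move=> [A CA]; exact: (Cf _ CA).1.
- by move=> [A CA]; exact: (Cf _ CA).2.
- move=> X [[A CA] XA].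
  have [||M [CM XM] hM] := Cl [set B | exists CB : sval C B, X (exist _ B CB)].
  + by move=> B [].
  + by exists A, CA.
  exists (exist _ M CM) => // -[B CB] XB BM; apply: hM; first by exists CB.
  by move=> eBM; apply: BM; exact: eq_exist.
- move=> A fA; apply: contrapT => /forallNP nA.
  have [|D tD [CD nDC]] := tower_family_extend (svalP C) fA.
    by move=> B CB; exact: nA (exist _ B CB).
  apply: nDC; suff <- : exist _ D tD = C by [].
  by apply: maxC; apply/asboolP.
Qed.

End TowerExistence.

(** * The well-order of a maximal tower *)

Section Tower.
Variables (W : Type) (T : W -> set nat).
Hypothesis Ttower : maximal_tower T.

Definition tower_lt (a b : W) : Prop := almost_lt (T a) (T b).
Definition tower_le (a b : W) : Prop := \forall k \near \oo, T a k -> T b k.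

Lemma tower_lexx (a : W) : tower_le a a.
Proof. exact: nearW. Qed.

Lemma tower_ltW (a b : W) : tower_lt a b -> tower_le a b.
Proof. by case. Qed.

Lemma tower_lt_geF (a b : W) : tower_lt a b -> ~ tower_le b a.
Proof. exact: almost_lt_asym. Qed.

Lemma tower_le_trans (b a c : W) : tower_le a b -> tower_le b c -> tower_le a c.
Proof. by apply: filterS2 => k ab bc /ab. Qed.

Lemma tower_lt_le_trans (b a c : W) :
  tower_lt a b -> tower_le b c -> tower_lt a c.
Proof.
move=> [ab fba] bc; split; first exact: tower_le_trans bc.
by apply: frequently_sub fba; apply: filterS bc => k bc [/bc].
Qed.

Lemma tower_le_lt_trans (b a c : W) :
  tower_le a b -> tower_lt b c -> tower_lt a c.
Proof.
move=> ab [bc fcb]; split; first exact: tower_le_trans bc.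
by apply: frequently_sub fcb; apply: filterS ab => k ab [ck nbk]; split=> // /ab.
Qed.

Lemma tower_ltgt (a b : W) : a <> b -> tower_lt a b \/ tower_lt b a.
Proof.
move=> ab; have [|m mX hm] := tower_least Ttower (X := [set a; b]).
  by exists a; left.
case: mX hm => -> h; [left|right]; apply: h.
- by right.
- by move=> ba; exact: ab.
- by left.
- exact: ab.
Qed.

Lemma tower_leNgt (a b : W) : ~ tower_le a b -> tower_lt b a.
Proof.
move=> nab; have [eab|/tower_ltgt[[]//|//]] := pselect (a = b).
by case: nab; rewrite eab; exact: tower_lexx.
Qed.

Lemma tower_min (X : set W) : X !=set0 ->
  exists2 m, X m & forall x, X x -> tower_le m x.
Proof.
move=> /(tower_least Ttower)[m Xm hm]; exists m => // x Xx.
have [->|xm] := pselect (x = m); first exact: tower_lexx.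
exact: tower_ltW (hm _ Xx xm).
Qed.

(** By maximality some [T b] meets the complement of [T a] in an infinite set. *)
Lemma tower_gt (a : W) : exists b, tower_lt a b.
Proof.
have [b fb] := tower_maximal Ttower (tower_cofrequently Ttower a).
exists b; apply: tower_leNgt => ba; apply: fb.
by apply: filterS ba => k ba [nak /ba].
Qed.

Lemma tower_inhabited : exists a : W, True.
Proof.
have fT : frequently setT by apply/frequentlyP => n; exists n.
by have [a _] := tower_maximal Ttower fT; exists a.
Qed.

(* If [h] were cofinal, a pseudo-intersection of the complements of the [T (h i)]
   would contradict maximality. *)
Lemma tower_countable_bound (h : nat -> W) :
  exists b, forall i, tower_lt (h i) b.
Proof.
suff [b hb] : exists b, forall i, tower_le (h i) b.
  by have [c bc] := tower_gt b; exists c => i; exact: tower_le_lt_trans bc.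
apply: contrapT => /forallNP hN.
have hmax i : exists m, forall j, (j <= i)%N -> tower_le (h j) m.
  elim: i => [|i [m hm]].
    by exists (h 0%N) => j; rewrite leqn0 => /eqP ->; exact: tower_lexx.
  have [mi|/tower_leNgt im] := pselect (tower_le m (h i.+1)).
    exists (h i.+1) => j; rewrite leq_eqVlt => /orP[/eqP ->|/hm jm].
      exact: tower_lexx.
    exact: tower_le_trans mi.
  exists m => j; rewrite leq_eqVlt => /orP[/eqP ->|/hm //]; exact: tower_ltW.
(* The range of [g] is the pseudo-intersection: [i <= g i] makes it infinite, and only the [g j]
   with [j < i] can lie in [T (h i)]. *)
have /choice[g hg] : forall i, exists k,
    (i <= k)%N /\ forall j, (j <= i)%N -> ~ T (h j) k.
  move=> i; have [m hm] := hmax i.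
  have hi : \forall k \near \oo, forall j : 'I_i.+1, T (h j) k -> T m k.
    by apply: filter_forall => j; apply: hm; rewrite -ltnS.
  have /frequentlyP/(_ i)[k ik nTk] : frequently
      [set k | forall j : 'I_i.+1, ~ T (h j) k].
    apply: frequently_sub (tower_cofrequently Ttower m).
    by apply: filterS hi => k hk nmk j /hk.
  exists k; split=> // j ji; exact: (nTk (Ordinal (ji : (j < i.+1)%N))).
have fg : frequently (range g).
  by apply/frequentlyP => n; exists (g n) => //; exact: (hg n).1.
have [a fa] := tower_maximal Ttower fg.
have /existsNP[i /tower_leNgt[hi _]] := hN a.
have ghi : \forall k \near \oo, forall j : 'I_i, (g j < k)%N.
  by apply: filter_forall => j; exists (g j).+1.
apply: fa; apply: filterS2 hi ghi => k ai gi [[j _ gk] /ai].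
rewrite -gk in gi *; have [ij|ji] := leqP i j; first exact: (hg j).2.
by have := gi (Ordinal ji); rewrite /= ltnn.
Qed.

Lemma tower_bound (K : countType) (h : K -> W) :
  exists b, forall i, tower_lt (h i) b.
Proof.
have [a _] := tower_inhabited.
have [b hb] := tower_countable_bound
  (fun i => if unpickle i is Some k then h k else a).
by exists b => k; have := hb (pickle k); rewrite pickleK.
Qed.

(* [Y] is the disjoint union of [nat] and [W], and [None] plays the role of the
   point at infinity of [Z]. *)
Local Notation Y := (nat + W)%type.
Local Notation Z := (option Y).

(* The sets [chi i] and their complements form a subbase of the topology of [Z]:
   the singletons of natural numbers, and the sets T_a with all b <= a. *)
Definition chi (i : Y) (z : Z) : Prop :=
  match i, z with
  | _, None => False
  | inl k, Some (inl l) => l = k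
  | inl k, Some (inr _) => False
  | inr a, Some (inl l) => T a l
  | inr a, Some (inr b) => tower_le b a
  end.

(** The points with a given trace along a finite list [s] form a basic clopen set, so [s] acts as
    the radius of a neighbourhood. *)
Definition trace (s : seq Y) (z : Z) : seq Prop := [seq chi i z | i <- s].

Lemma trace_cat (s t : seq Y) (z w : Z) :
  trace (s ++ t) z = trace (s ++ t) w -> trace s z = trace s w /\
  trace t z = trace t w.
Proof.
rewrite /trace !map_cat => h.
split; first by have := congr1 (take (size s)) h; rewrite !take_size_cat ?size_map.
by have := congr1 (drop (size s)) h; rewrite !drop_size_cat ?size_map.
Qed.

Lemma trace_cons (i : Y) (s : seq Y) (z w : Z) :
  trace (i :: s) z = trace (i :: s) w -> chi i z = chi i w.
Proof. by case. Qed.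

Lemma near_trace (F : set_system nat) (u : nat -> Z) (z : Z) (s : seq Y) :
  Filter F -> (forall i, \forall n \near F, chi i (u n) = chi i z) ->
  \forall n \near F, trace s (u n) = trace s z.
Proof.
move=> FF h; elim: s => [|i s IH]; first exact: nearW.
by apply: filterS2 (h i) IH => n /= -> ->.
Qed.

(** The arbitrary tail [s] lets the separating index head a longer list. *)
Lemma trace_separate (z w : Z) :
  z <> w -> exists i, forall s, trace (i :: s) z <> trace (i :: s) w.
Proof.
move=> zw; suff [i hi] : exists i, chi i z <> chi i w.
  by exists i => s /trace_cons.
case: z w zw => [[k|a]|] [[l|b]|] zw //=.
- exists (inl k) => /= e; apply: zw; have : l = k by rewrite -e.
  by move=> ->.
- by exists (inl k) => /= e; have : False by rewrite -e.
- by exists (inl k) => /= e; have : False by rewrite -e.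
- by exists (inl l) => /= e; have : False by rewrite e.
- have ab : a <> b by move=> ab; apply: zw; rewrite ab.
  have [/tower_lt_geF h|/tower_lt_geF h] := tower_ltgt ab.
    by exists (inr a) => /= e; apply: h; rewrite -e; exact: tower_lexx.
  by exists (inr b) => /= e; apply: h; rewrite e; exact: tower_lexx.
- by exists (inr a) => /= e; have : False by rewrite -e; exact: tower_lexx.
- by exists (inl l) => /= e; have : False by rewrite e.
- by exists (inr b) => /= e; have : False by rewrite e; exact: tower_lexx.
Qed.

(** This is density of the naturals in [Z]. Near [inr a] lie almost all numbers of [T a] outside
    finitely many [T c] with [c] below [a]; near infinity, almost all those outside finitely many
    [T c]. These sets are infinite because the tower increases strictly and its members are
    coinfinite. *)
Lemma trace_dense (z : Z) (s : seq Y) :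
  exists k, trace s (Some (inl k)) = trace s z.
Proof.
have [[k ->]|nz] := pselect (exists k, z = Some (inl k)); first by exists k.
(* Every subbasic set [chi i] that contains [z] contains almost all of [A]. *)
pose A := if z is Some (inr a) then T a else setT.
have chiA i : chi i z -> \forall k \near \oo, A k -> chi i (Some (inl k)).
  rewrite /A {A}; case: z nz => [[k|a]|] nz; first by case: nz; exists k.
    by case: i.
  by case: i.
(* A condition that fails at [z] excludes one [T c], or a finite set, for which [set0] stands. *)
have chiN i : ~ chi i z -> exists2 M, M = set0 \/ (exists2 c, M = T c & ~ chi (inr c) z)
    & \forall k \near \oo, chi i (Some (inl k)) -> M k.
  case: i => [l _|c nc]; last by exists (T c); [right; exists c|exact: nearW].
  by exists set0; [left|exists l.+1 => // k /= lk kl; rewrite kl ltnn in lk].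
(* A finite union of sets [T c] is almost contained in one of them. *)
have [M MT hM] : exists2 M, M = set0 \/ (exists2 c, M = T c & ~ chi (inr c) z)
    & \forall k \near \oo, A k -> ~ M k -> trace s (Some (inl k)) = trace s z.
  elim: s => [|i s [M MT hM]]; first by exists set0; [left|exact: nearW].
  have [iz|niz] := pselect (chi i z).
    exists M => //; apply: filterS2 (chiA _ iz) hM => k Ai hk Ak nMk /=.
    rewrite (hk Ak nMk); congr cons; apply: propext; split=> // _; exact: Ai.
  have [N NT hN] := chiN _ niz.
  have [L LT [hL1 hL2]] : exists2 L, L = set0 \/ (exists2 c, L = T c & ~ chi (inr c) z)
      & (\forall k \near \oo, M k -> L k) /\ (\forall k \near \oo, N k -> L k).
    have [M0|[c Mc nc]] := MT.
      by exists N => //; split; apply: nearW => // k; rewrite M0.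
    have [N0|[d Nd nd]] := NT.
      by exists M => //; split; apply: nearW => // k; rewrite N0.
    rewrite Mc Nd; have [cd|/tower_leNgt/tower_ltW dc] := pselect (tower_le c d).
      by exists (T d); [right; exists d|split=> //; exact: nearW].
    by exists (T c); [right; exists c|split=> //; exact: nearW].
  exists L => //.
  apply: filterS2 (filterI hL1 hL2) (filterI hM hN) => k [ML NL] [hk hNk] Ak nLk /=.
  rewrite hk // => [|/ML//]; congr cons; apply: propext.
  by split=> // /hNk /NL.
have fAM : frequently (A `\` M).
  have fA : frequently A.
    rewrite /A; case: (z) => [[k|a]|]; last 1 first.
    - by apply/frequentlyP => n; exists n.
    - by apply/frequentlyP => n; exists n.
    - exact: tower_frequently.
  have [->|[c -> nc]] := MT; first by rewrite setD0.
  rewrite /A {A chiA chiN MT hM fA}; case: z nz nc => [[k|a]|] nz nc.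
  - by case: nz; exists k.
  - by have [] := tower_leNgt nc.
  - by rewrite setTD; exact: tower_cofrequently.
apply: frequently_ex; apply: frequently_sub fAM.
by apply: filterS hM => k hk [Ak nMk]; exact: hk.
Qed.

(** * Convergence of sequences in [Z], tested on the subbase *)

Definition tower_cvg (u : nat -> Z) (z : Z) : Prop :=
  forall i, \forall n \near \oo, chi i (u n) = chi i z.

Lemma tower_cvg_trace (u : nat -> Z) (z : Z) (s : seq Y) :
  tower_cvg u z -> \forall n \near \oo, trace s (u n) = trace s z.
Proof. exact: near_trace. Qed.

Lemma tower_cvg_cst (z : Z) : tower_cvg (fun=> z) z.
Proof. by move=> i; exact: nearW. Qed.

Lemma tower_cvg_subseq (u : nat -> Z) (f : nat -> nat) (z : Z) :
  increasing_seq f -> tower_cvg u z -> tower_cvg (u \o f) z.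
Proof. by move=> fi uz i; exact: near_subseq (uz i). Qed.

(** Infinity is the limit of [W]: no [chi i] holds at infinity, and [chi (inr c)] fails beyond
    [c]. *)
Lemma trace_tail (s : seq Y) :
  exists a, forall b, tower_lt a b -> trace s (Some (inr b)) = trace s None.
Proof.
elim: s => [|i s [a ha]]; first by have [a _] := tower_inhabited; exists a.
case: i => [k|c].
  by exists a => b /ha /= ->.
pose h (i : bool) := if i then a else c.
have [d hd] := tower_bound h; exists d => b db /=.
rewrite ha; last exact: tower_lt_le_trans (hd true) (tower_ltW db).
congr cons; apply: propext; split=> // bc.
exact: (tower_lt_geF (tower_lt_le_trans (hd false) (tower_ltW db))) bc.
Qed.

(** The limit is the least strict upper bound [c]. An [a] below [c] does not bound the sequence,
    which therefore eventually stays above [a]. *)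
Lemma tower_cvg_sup (b : nat -> W) : (forall i, tower_lt (b i) (b i.+1)) ->
  exists2 c, forall i, tower_lt (b i) c
    & tower_cvg (fun i => Some (inr (b i))) (Some (inr c)).
Proof.
move=> bi; have bmono i j : (i <= j)%N -> tower_le (b i) (b j).
  move=> /subnKC <-; elim: (j - i)%N => [|k IH]; first by rewrite addn0; exact: tower_lexx.
  by rewrite addnS; apply: tower_le_trans IH (tower_ltW _).
have [|c hc cmin] := tower_min (X := [set c | forall i, tower_lt (b i) c]).
  by have [c hc] := tower_countable_bound b; exists c.
exists c => // -[k|a]; first exact: nearW.
have [ca|nca] := pselect (tower_le c a).
  apply: nearW => i /=; apply: propext; split=> // _.
  exact: tower_le_trans (tower_ltW (hc i)) ca.
have /existsNP[i /= hi] : ~ forall i, tower_le (b i) a.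
  by move=> h; apply: nca; apply: cmin => i; exact: tower_lt_le_trans (bi i) (h _).
exists i => // j /= ij; apply: propext; split=> // bja.
by case: hi; exact: tower_le_trans (bmono _ _ ij) bja.
Qed.

(** The terms in [W] have a bound [b], so such a sequence would eventually consist of naturals and
    take infinitely many values. By maximality infinitely many of these lie in some [T a], whose
    subbasic set misses infinity. *)
Lemma tower_cvg_not_infty (v : nat -> Y) : ~ tower_cvg (Some \o v) None.
Proof.
move=> vN; have [a0 _] := tower_inhabited.
have [b hb] := tower_countable_bound (fun i => if v i is inr a then a else a0).
pose A := [set k | exists i, v i = inl k].
have fA : frequently A.
  apply/frequentlyP => n.
  have vn : \forall i \near \oo, forall k : 'I_n, chi (inl (k : nat)) (Some (v i)) = False.
    by apply: filter_forall => k; exact: vN.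
  have [i [/= hi]] : exists i, chi (inr b) (Some (v i)) = False /\
      forall k : 'I_n, chi (inl (k : nat)) (Some (v i)) = False.
    by have [N _ hN] := filterI (vN (inr b)) vn; exists N; exact: hN (leqnn N).
  have := hb i; case vi: (v i) hi => [k|a] /= hi hbi hk; last first.
    by exfalso; rewrite -hi; exact: tower_ltW hbi.
  exists k; last by exists i.
  by rewrite leqNgt; apply/negP => kn; rewrite -(hk (Ordinal kn)) /=.
have [a fa] := tower_maximal Ttower fA.
have [N _ hN] := vN (inr a).
have vbound : \forall k \near \oo, forall i : 'I_N, v i <> inl k.
  apply: filter_forall => i; case: (v i) => [l|c]; last exact: nearW.
  by exists l.+1 => // k /= lk [lk']; rewrite lk' ltnn in lk.
apply: fa; apply: filterS vbound => k hk [[i vi] ak].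
have [Ni|iN] := leqP N i; last exact: (hk (Ordinal iN)).
by have := hN i Ni; rewrite /= vi /= => <-.
Qed.

(** If no natural recurs infinitely often, the limit is the least [a] whose subbasic set contains
    infinitely many terms, or infinity if there is no such [a]. *)
Lemma tower_cvg_subseq_exists (u : nat -> Z) :
  exists2 f : nat -> nat, increasing_seq f & exists z, tower_cvg (u \o f) z.
Proof.
have [[k /frequently_subseq[f fi fk]]|/forallNP ninl] :=
    pselect (exists k, frequently [set i | u i = Some (inl k)]).
  exists f => //; exists (Some (inl k)).
  by move=> i; apply: nearW => n; rewrite /= fk.
pose X := [set a | frequently [set i | chi (inr a) (u i)]].
have uinl k : \forall i \near \oo, u i <> Some (inl k).
  exact: (contrapT (ninl k)).
have cinl k : \forall i \near \oo, chi (inl k) (u i) = False.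
  apply: filterS (uinl k) => i; case: (u i) => [[l|a]|] //= ulk.
  by apply: propext; split=> // lk; apply: ulk; rewrite lk.
have [X0|/set0P/negP/negPn/eqP X0] := pselect (X !=set0); last first.
  exists id => //; exists None => -[k|a]; first exact: cinl.
  have /contrapT : ~ X a by rewrite X0.
  by apply: filterS => i h; exact: propext.
have [a /frequently_subseq[f fi fa] amin] := tower_min X0.
exists f => //; exists (Some (inr a)) => -[k|b].
  exact: (near_subseq fi (cinl k)).
have [ab|nab] := pselect (tower_le a b).
  have [N _ hN] := ab.
  have uN : \forall i \near \oo, forall k : 'I_N, u (f i) <> Some (inl (k : nat)).
    by apply: filter_forall => k; exact: near_subseq (uinl k).
  apply: filterS uN => i hi; apply: propext; split=> // _.
  move: hi (fa i) => /=; case: (u (f i)) => [[k|c]|] //= hi.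
    have [Nk|kN] := leqP N k; first exact: hN.
    by case: (hi (Ordinal kN)).
  by move=> ca; exact: tower_le_trans ab.
have /contrapT : ~ X b by move=> /amin.
move=> /(near_subseq fi); apply: filterS => i h.
by apply: propext; split=> // /h.
Qed.

End Tower.

(** * The chain of planks *)

(* The plank number [n] consists of the points [inl (n, (x, y))]; its missing
   right edge {infinity} x Y is glued to the top edge Y x {infinity} of the plank
   number [n + 1].  The points [inr true] and [inr false] are the two ends of the
   chain of planks. *)
Definition chain_space (W : Type) (T : W -> set nat) : Type :=
  (int * ((nat + W) * option (nat + W)) + bool)%type.

HB.instance Definition _ W (T : W -> set nat) := gen_eqMixin (chain_space T).
HB.instance Definition _ W (T : W -> set nat) := gen_choiceMixin (chain_space T).

Section ChainSpace.
Variables (W : Type) (T : W -> set nat).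

Local Notation Y := (nat + W)%type.
Local Notation Z := (option Y).
Local Notation trace := (trace T).

Definition plank_pt (n : int) (x : Y) (y : Z) : chain_space T := inl (n, (x, y)).
Definition chain_end (b : bool) : chain_space T := inr b.

Definition beyond (b : bool) (N n : int) : bool :=
  if b then (N <= n)%R else (n <= N)%R.

Lemma beyond_trans (b : bool) (M N n : int) :
  beyond b M N -> beyond b N n -> beyond b M n.
Proof. by case: b => /= *; lia. Qed.

Lemma beyond_common (b : bool) (M N : int) :
  exists K, beyond b M K /\ beyond b N K.
Proof.
by case: b; [exists (Num.max M N)|exists (Num.min M N)]; split=> /=; lia.
Qed.

(** Declaring the open sets directly avoids a quotient. The second clause describes, inside plank
    [n], the neighbourhoods of a point of its right edge, which is the point [(y, None)] of plank
    [n + 1]; there [Some y'] suffices as [Y] is open in [Z]. *)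
Definition chain_open (U : set (chain_space T)) : Prop :=
  [/\ forall n x y, U (plank_pt n x y) -> exists s, forall x' y',
        trace s (Some x') = trace s (Some x) -> trace s y' = trace s y ->
        U (plank_pt n x' y'),
      forall n y, U (plank_pt (n + 1) y None) -> exists s, forall x' y',
        trace s (Some x') = trace s None ->
        trace s (Some y') = trace s (Some y) -> U (plank_pt n x' (Some y'))
    & forall b, U (chain_end b) -> exists N, forall n x y,
        beyond b N n -> U (plank_pt n x y)].

Lemma chain_openT : chain_open setT.
Proof. by split=> *; [exists nil|exists nil|exists 0%R]. Qed.

Lemma chain_openI : setI_closed chain_open.
Proof.
move=> U V [U1 U2 U3] [V1 V2 V3]; split=> [n x y|n y|b] [Up Vp].
- have [s hs] := U1 _ _ _ Up; have [t ht] := V1 _ _ _ Vp.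
  exists (s ++ t) => x' y' /trace_cat[sx tx] /trace_cat[sy ty].
  by split; [exact: hs|exact: ht].
- have [s hs] := U2 _ _ Up; have [t ht] := V2 _ _ Vp.
  exists (s ++ t) => x' y' /trace_cat[sx tx] /trace_cat[sy ty].
  by split; [exact: hs|exact: ht].
- have [M hM] := U3 _ Up; have [N hN] := V3 _ Vp.
  have [K [MK NK]] := beyond_common b M N.
  exists K => n x y Kn; split; [apply: hM|apply: hN]; exact: beyond_trans Kn.
Qed.

Lemma chain_open_bigcup (I : Type) (F : I -> set (chain_space T)) :
  (forall i, chain_open (F i)) -> chain_open (\bigcup_i F i).
Proof.
move=> FO; split=> [n x y|n y|b] [i _ Fp]; have [F1 F2 F3] := FO i.
- by have [s hs] := F1 _ _ _ Fp; exists s => x' y' hx hy; exists i => //; exact: hs.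
- by have [s hs] := F2 _ _ Fp; exists s => x' y' hx hy; exists i => //; exact: hs.
- by have [N hN] := F3 _ Fp; exists N => m x y hm; exists i => //; exact: hN.
Qed.

End ChainSpace.

HB.instance Definition _ W (T : W -> set nat) :=
  isOpenTopological.Build (chain_space T)
    (chain_openT T) (@chain_openI W T) (@chain_open_bigcup W T).

(** * Regularity, separability and sequential compactness of the chain *)

Section ChainSpaceTheory.
Variables (W : Type) (T : W -> set nat).
Hypothesis Ttower : maximal_tower T.

Local Notation Y := (nat + W)%type.
Local Notation Z := (option Y).
Local Notation trace := (trace T).
Local Notation S := (chain_space T).
Local Notation pt := (plank_pt T).
Local Notation End := (chain_end T).

Lemma chain_openE (U : set S) : open U = chain_open U.
Proof. by []. Qed.

Lemma nbhs_plank_pt (n : int) (x : Y) (y : Z) (A : set S) :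
  nbhs (pt n x y) A -> exists s, forall x' y',
    trace s (Some x') = trace s (Some x) -> trace s y' = trace s y ->
    A (pt n x' y').
Proof.
rewrite nbhsE => -[U [[U1 _ _] Up] UA]; have [s hs] := U1 _ _ _ Up.
by exists s => x' y' hx hy; apply: UA; exact: hs.
Qed.

Lemma nbhs_plank_edge (n : int) (y : Y) (A : set S) :
  nbhs (pt (n + 1) y None) A -> exists s, forall x' y',
    trace s (Some x') = trace s None -> trace s (Some y') = trace s (Some y) ->
    A (pt n x' (Some y')).
Proof.
rewrite nbhsE => -[U [[_ U2 _] Up] UA]; have [s hs] := U2 _ _ Up.
by exists s => x' y' hx hy; apply: UA; exact: hs.
Qed.

Lemma cvg_plank_pt (n : int) (x : nat -> Y) (y : nat -> Z) (x0 : Y) (y0 : Z) :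
  tower_cvg T (Some \o x) (Some x0) -> tower_cvg T y y0 ->
  pt n (x i) (y i) @[i --> \oo] --> pt n x0 y0.
Proof.
move=> xx0 yy0 A /nbhs_plank_pt[s hs].
have hx := tower_cvg_trace s xx0; have hy := tower_cvg_trace s yy0.
by apply: filterS2 hx hy => i /= hx hy; exact: hs.
Qed.

Lemma cvg_chain_end (b : bool) (n : nat -> int) (x : nat -> Y) (y : nat -> Z) :
  (forall N, \forall i \near \oo, beyond b N (n i)) ->
  pt (n i) (x i) (y i) @[i --> \oo] --> End b.
Proof.
move=> nb A; rewrite nbhsE => -[U [[_ _ U3] Up] UA]; have [N hN] := U3 _ Up.
by apply: filterS (nb N) => i hi; apply: UA; exact: hN.
Qed.

Lemma chain_open_setC1 (p : S) : open (~` [set p]).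
Proof.
rewrite chain_openE; split=> [n x y np|n y np|b np].
- case: p np => [[m [x0 y0]]|b] np; last by exists nil => x' y' _ _.
  have [xx0|xx0] := pselect (Some x = Some x0).
    have yy0 : y <> y0 \/ n <> m.
      apply: contrapT => /not_orP[/contrapT yy0 /contrapT nm]; apply: np.
      by case: xx0 => ->; rewrite yy0 nm.
    have [/(trace_separate Ttower)[i hi]|nm] := yy0.
      exists [:: i] => x' y' _ hy [_ _ ey]; apply: (hi nil).
      by rewrite -hy ey.
    by exists nil => x' y' _ _ [].
  have [i hi] := trace_separate Ttower xx0.
  exists [:: i] => x' y' hx _ [_ ex _]; apply: (hi nil).
  by rewrite -hx ex.
- case: p {np} => [[m [x0 y0]]|b]; last by exists nil => x' y' _ _.
  have /(trace_separate Ttower)[i hi] : Some x0 <> None by [].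
  exists [:: i] => x' y' hx _ [_ ex _]; apply: (hi nil).
  by rewrite -hx ex.
- case: p np => [[m [x0 y0]]|b'] np; last by exists 0%R.
  have [N bN] : exists N, ~~ beyond b N m.
    by case: b {np}; [exists (m + 1)%R|exists (m - 1)%R] => /=; lia.
  by exists N => n x y Nn [nm _ _]; rewrite -nm Nn in bN.
Qed.

Lemma chain_accessible : accessible_space S.
Proof.
move=> p q /eqP pq; exists (~` [set q]); split; first exact: chain_open_setC1.
  by rewrite inE.
by rewrite inE; apply.
Qed.

(** Membership in [V] depends on traces along one list [s], consistently across the glued edges, so
    the same [s] serves for [V] and for its complement. *)
Lemma chain_clopen (s : seq Y) (V : set S) :
  (forall n x y x' y', trace s (Some x') = trace s (Some x) ->
     trace s y' = trace s y -> V (pt n x y) -> V (pt n x' y')) ->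
  (forall n y x' y', trace s (Some x') = trace s None ->
     trace s (Some y') = trace s (Some y) ->
     V (pt (n + 1) y None) <-> V (pt n x' (Some y'))) ->
  (forall b, ~ V (End b)) ->
  (forall b, exists N, forall n x y, beyond b N n -> ~ V (pt n x y)) ->
  open V /\ closed V.
Proof.
move=> V1 V2 V3 V4; split.
  rewrite chain_openE; split=> [n x y Vp|n y Vp|b /V3//].
    by exists s => x' y' hx hy; exact: V1 Vp.
  by exists s => x' y' hx hy; apply/(V2 _ _ _ _ hx hy).
rewrite -openC chain_openE; split=> [n x y Vp|n y Vp|b _]; last exact: V4.
  by exists s => x' y' hx hy Vp'; apply: Vp; apply: V1 Vp'.
by exists s => x' y' hx hy Vp'; apply: Vp; apply/(V2 _ _ _ _ hx hy).
Qed.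

(* The top edge of the plank [N] lies in the closure of [chain_lower N]. *)
Definition chain_upper (N : int) : set S := [set p : S | match p with
  | inl (m, (_, y)) => (N < m)%R \/ m = N /\ y <> None
  | inr b => is_true b end].
Definition chain_lower (N : int) : set S := [set p : S | match p with
  | inl (m, _) => (m < N)%R
  | inr b => is_true (~~ b) end].

Lemma open_chain_upper (N : int) : open (chain_upper N).
Proof.
rewrite chain_openE; split=> [n x y [Nn|[nN yN]]|n y [Nn|[_ //]]|[] // _].
- by exists nil => x' y' _ _; left.
- have [i hi] := trace_separate Ttower yN.
  exists [:: i] => x' y' _ hy; right; split=> // y'N; apply: (hi nil).
  by rewrite -hy y'N.
- exists nil => x' y' _ _ /=.
  by have [->|nN] := eqVneq n N; [right|left; lia].
- by exists (N + 1)%R => n x y /= Nn; left; lia.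
Qed.

Lemma open_chain_lower (N : int) : open (chain_lower N).
Proof.
rewrite chain_openE; split=> [n x y /= nN|n y /= nN|[] // _].
- by exists nil.
- by exists nil => x' y' _ _ /=; lia.
- by exists (N - 1)%R => n x y /= Nn; lia.
Qed.

(** A plank point has a clopen neighbourhood inside [U]. At an end, [F] exceeds [V] only by the top
    edge of plank [N]. *)
Lemma chain_separate_point (U : set S) (p : S) : open U -> U p ->
  exists V F, [/\ open V, closed F, V p, V `<=` F & F `<=` U].
Proof.
rewrite chain_openE => -[U1 U2 U3].
case: p => [[n [x y]] Up|b Up].
  have [s0 hs0] := U1 _ _ _ Up.
  have /(trace_separate Ttower)[i hi] : Some x <> None by [].
  have [j hj] : exists j, y <> None -> forall s, trace (j :: s) y <> trace (j :: s) None.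
    have [->|/(trace_separate Ttower)[j hj]] := pselect (y = None).
      by exists i.
    by exists j.
  (* A point of a top edge also has a neighbourhood in the preceding plank. *)
  have [s1 hs1] : exists s1, y = None -> forall x' y',
      trace s1 (Some x') = trace s1 None ->
      trace s1 (Some y') = trace s1 (Some x) -> U (pt (n - 1) x' (Some y')).
    have [yN|] := pselect (y = None); last by exists nil.
    have [|s1 hs1] := U2 (n - 1)%R x; first by rewrite subrK -yN.
    by exists s1.
  (* The index [i] keeps the box away from the right edge, and [j] keeps it away from the top edge
     unless [y = None]. *)
  pose s := i :: j :: s0 ++ s1.
  have hix : trace s (Some x) <> trace s None by exact: hi.
  have hjy : y <> None -> trace s y <> trace s None.
    move=> yN e; apply: (hj yN (s0 ++ s1)).
    by move: e; rewrite /s -cat1s => /trace_cat[].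
  have sl z w : trace s z = trace s w -> trace s0 z = trace s0 w.
    by rewrite /s -cat1s => /trace_cat[_]; rewrite -cat1s => /trace_cat[_ /trace_cat[]].
  have sr z w : trace s z = trace s w -> trace s1 z = trace s1 w.
    by rewrite /s -cat1s => /trace_cat[_]; rewrite -cat1s => /trace_cat[_ /trace_cat[]].
  (* When [y = None], the matching box in plank [n - 1] is added, cut out by the same [s] so that
     the two agree along the glued edge. *)
  pose V : set S := [set p : S | match p with
    | inl (m, (x', y')) =>
        [/\ m = n, trace s (Some x') = trace s (Some x) & trace s y' = trace s y]
        \/ [/\ y = None, m = (n - 1)%R, trace s (Some x') = trace s None
             & trace s y' = trace s (Some x)]
    | inr _ => False end].
  have [] := @chain_clopen s V.
  - move=> m x1 y1 x' y' hx hy [[? ? ?]|[? ? ? ?]]; [left|right]; split=> //;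
      by rewrite ?hx ?hy.
  - move=> m y1 x' y' hx hy; split.
      move=> [[mn h1 h2]|[_ _ _ /esym]]; last by [].
      have yN : y = None by apply: contrapT => /hjy; apply.
      by right; split=> //; [lia|rewrite hy].
    move=> [[_ h _]|[yN -> h1 h2]]; first by case: hix; rewrite -h.
    by left; split; [lia|rewrite -hy|rewrite yN].
  - by move=> b [].
  - case; [exists (n + 1)%R|exists (n - 2)%R] => m x' y' /= hm [[? _ _]|[_ ? _ _]]; lia.
  move=> oV cV; exists V, V; split=> //; first by left.
  move=> [[m [x' y']]|//] [[-> hx hy]|[yN -> hx hy]].
    by apply: hs0; exact: sl.
  case: y' hy => [y'|/esym//] hy.
  by apply: (hs1 yN); exact: sr.
have [N hN] := U3 _ Up; case: b Up hN => Up hN.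
  exists (chain_upper N), (~` chain_lower N); split=> //.
  - exact: open_chain_upper.
  - by apply: open_closedC; exact: open_chain_lower.
  - move=> [[m [x y]]|[]] //= [Nm|[-> _]]; last by rewrite ltxx.
    by move=> mN; lia.
  - move=> [[m [x y]]|[]] //= mN; apply: hN => /=; lia.
exists (chain_lower N), (~` chain_upper N); split=> //.
- exact: open_chain_lower.
- by apply: open_closedC; exact: open_chain_upper.
- move=> [[m [x y]]|[]] //= mN [Nm|[mN' _]]; lia.
- move=> [[m [x y]]|[]] //= mN; apply: hN => /=.
  by rewrite leNgt; apply/negP => Nm; apply: mN; left.
Qed.

Lemma chain_regular : regular_space S.
Proof.
move=> p A; rewrite nbhsE => -[U [oU Up] UA].
have [V [F [oV cF Vp VF FU]]] := chain_separate_point oU Up.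
exists V; first by exists V.
apply: subset_trans UA; apply: subset_trans FU.
by rewrite [F in _ `<=` F](closure_id F).1 //; exact: closure_subset.
Qed.

(** Every nonempty open set contains a plank point, and the naturals are dense in each
    coordinate. *)
Lemma chain_separable : separable_space S.
Proof.
pose d (t : int * nat * nat) := pt t.1.1 (inl t.1.2) (Some (inl t.2)).
exists (range d); first exact: sub_countable (card_image_le _ _) (countableP _).
move=> U [p Up] oU; have [U1 _ U3] := oU.
have [n [x [y Uq]]] : exists n x y, U (pt n x y).
  case: p Up => [[n [x y]]|b] Up; first by exists n, x, y.
  have [N hN] := U3 _ Up; exists N, (inl 0%N), None; apply: hN.
  by case: (b) => /=.
have [s hs] := U1 _ _ _ Uq.
have [k hk] := trace_dense Ttower (Some x) s.
have [l hl] := trace_dense Ttower y s.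
by exists (d (n, k, l)); split; [exact: hs|exists (n, k, l)].
Qed.

(** If no integer is taken infinitely often, the absolute values tend to infinity and one sign
    recurs. *)
Lemma int_subseq (n : nat -> int) : exists2 f, increasing_seq f &
  (exists m, forall i, n (f i) = m)
  \/ exists b, forall N, \forall i \near \oo, beyond b N (n (f i)).
Proof.
have [[m /frequently_subseq[f fi fm]]|/forallNP nm] :=
    pselect (exists m, frequently [set i | n i = m]).
  by exists f => //; left; exists m.
have {}nm m : \forall i \near \oo, n i <> m by exact: contrapT (nm m).
have habs K : \forall i \near \oo, (K < `|n i|)%N.
  elim: K => [|K IH].
    by apply: filterS (nm 0%R) => i; lia.
  have nK := nm (Posz K.+1); have nNK := nm (- Posz K.+1)%R.
  near=> i.
  have nKi : n i <> Posz K.+1 by near: i.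
  have nNKi : n i <> (- Posz K.+1)%R by near: i.
  have Ki : (K < `|n i|)%N by near: i.
  lia.
have hb (b : bool) f : increasing_seq f ->
    (forall i, if b then (0 <= n (f i))%R else (n (f i) < 0)%R) ->
    forall N, \forall i \near \oo, beyond b N (n (f i)).
  move=> fi fb N; apply: filterS (near_subseq fi (habs `|N|%N)) => i.
  by case: b fb => /(_ i) /=; lia.
have fT : frequently setT by apply/frequentlyP => i; exists i.
have [/frequently_subseq[f fi fA]|/frequently_subseq[f fi fA]] :=
    frequently_split [set i | (0 <= n i)%R] fT.
  by exists f => //; right; exists true; apply: hb => // i; exact: (fA i).2.
exists f => //; right; exists false; apply: hb => // i.
by have [_ /= /negP] := fA i; rewrite -ltNge.
Unshelve. all: by end_near. Qed.

(** Unless an end recurs, subsequences are chosen in turn for the plank number, the first coordinate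
    and the second. *)
Lemma chain_sequentially_compact : sequentially_compact_space S.
Proof.
move=> u.
have [[b /frequently_subseq[f fi fb]]|/forallNP nb] :=
    pselect (exists b, frequently [set i | u i = End b]).
  exists f => //; exists (End b).
  by apply: cvg_near_cst; apply: nearW => i; rewrite /= fb.
have /frequently_subseq[f0 f0i f0u] :
    frequently [set i | exists n x y, u i = pt n x y].
  move=> h; suff [N _ hN] : \forall i \near \oo, False by exact: (hN N (leqnn N)).
  have {}nb b : \forall i \near \oo, u i <> End b by exact: contrapT (nb b).
  apply: filterS2 h (filterI (nb true) (nb false)) => i /=.
  case: (u i) => [[n [x y]]|[]] h [nt nf]; [|exact: nt|exact: nf].
  by apply: h; exists n, x, y.
have /choice[q hq] : forall i, exists q, u (f0 i) = pt q.1 q.2.1 q.2.2.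
  by move=> i; have [n [x [y ->]]] := f0u i; exists (n, (x, y)).
have [f1 f1i hn] := int_subseq (fun i => (q i).1).
have [f2 f2i [x0 hx]] := tower_cvg_subseq_exists Ttower
  (fun i => Some (q (f1 i)).2.1).
have [f3 f3i [y0 hy]] := tower_cvg_subseq_exists Ttower
  (fun i => (q (f1 (f2 i))).2.2).
(* The first coordinates lie in [Y], so their limit is not infinity. *)
case: x0 hx => [x0|] hx; last by case: (tower_cvg_not_infty Ttower hx).
exists (f0 \o f1 \o f2 \o f3).
  by do 3! apply: increasing_seq_comp => //.
pose g := f1 \o f2 \o f3.
have -> : u \o (f0 \o f1 \o f2 \o f3) =
    fun i => pt (q (g i)).1 (q (g i)).2.1 (q (g i)).2.2.
  by apply/funext => i; exact: hq.
have f23 : increasing_seq (f2 \o f3) by exact: increasing_seq_comp.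
case: hn => [[m hm]|[b hb]].
  exists (pt m x0 y0).
  have -> : (fun i => pt (q (g i)).1 (q (g i)).2.1 (q (g i)).2.2) =
      fun i => pt m (q (g i)).2.1 (q (g i)).2.2.
    by apply/funext => i; rewrite hm.
  exact: cvg_plank_pt (tower_cvg_subseq f3i hx) hy.
exists (End b); apply: cvg_chain_end => N.
exact: near_subseq f23 (hb N).
Qed.

(** * Continuous real functions on the chain *)

Section RealFunctions.
Variables (R : realType).

(** Each tolerance [1/(k+1)] has a threshold in [W], and countably many thresholds have a common
    bound. *)
Lemma tower_eventually_eq (g : W -> R) (r : R) :
  (forall e : R, (0 < e)%R -> exists a, forall b, tower_lt T a b -> `|r - g b| < e)%R ->
  exists a, forall b, tower_lt T a b -> g b = r.
Proof.
move=> gr.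
have /choice[h hh] : forall k : nat, exists a, forall b, tower_lt T a b ->
    (`|r - g b| < k.+1%:R^-1)%R by move=> k; apply: gr.
have [a ha] := tower_bound Ttower h.
exists a => b ab; apply/eqP; rewrite eq_sym -subr_eq0 -normr_eq0 eq_le normr_ge0.
rewrite andbT; apply/ler_addgt0Pl => e e0; rewrite addr0.
have [k _ hk] := near_infty_natSinv_lt (PosNum e0).
apply: ltW; apply: lt_trans (hk k (leqnn k)).
by apply: hh; exact: tower_lt_le_trans (ha k) (tower_ltW ab).
Qed.

Variable f : S -> R.
Hypothesis fcont : continuous f.

Lemma continuous_dist_nbhs (p : S) (e : R) :
  (0 < e)%R -> nbhs p [set q | `|f p - f q| < e]%R.
Proof.
have fp : f q @[q --> p] --> f p := fcont (x := p).
by move=> e0; move/cvgrPdist_lt : fp; apply.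
Qed.

Lemma top_edge_eventually (n : int) (b : W) : exists a, forall c, tower_lt T a c ->
  f (pt n (inr b) (Some (inr c))) = f (pt n (inr b) None).
Proof.
apply: tower_eventually_eq => e /(continuous_dist_nbhs (pt n (inr b) None)).
move=> /nbhs_plank_pt[s hs]; have [a ha] := trace_tail Ttower s.
by exists a => c /ha ac; exact: hs.
Qed.

Lemma right_edge_eventually (n : int) (b : W) : exists a, forall c, tower_lt T a c ->
  f (pt n (inr c) (Some (inr b))) = f (pt (n + 1) (inr b) None).
Proof.
apply: tower_eventually_eq => e /(continuous_dist_nbhs (pt (n + 1) (inr b) None)).
move=> /nbhs_plank_edge[s hs]; have [a ha] := trace_tail Ttower s.
by exists a => c /ha ac; exact: hs.
Qed.

(* On a long enough increasing sequence [b] the values on both edges are attained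
   inside the planks; at its supremum [c] both edges have the value of the diagonal
   point. *)
Lemma edges_agree :
  exists c, forall n, f (pt (n + 1) (inr c) None) = f (pt n (inr c) None).
Proof.
have /choice[g hg] : forall b, exists a, tower_lt T b a /\ forall c n, tower_lt T a c ->
    f (pt n (inr b) (Some (inr c))) = f (pt n (inr b) None) /\
    f (pt n (inr c) (Some (inr b))) = f (pt (n + 1) (inr b) None).
  move=> b; have /choice[h1 hh1] := top_edge_eventually^~ b.
  have /choice[h2 hh2] := right_edge_eventually^~ b.
  (* One bound serves all integers [n] and both edges; the value at [None] puts it above [b]. *)
  pose h (k : option (int * bool)) :=
    if k is Some (n, i) then if i then h1 n else h2 n else b.
  have [a ha] := tower_bound Ttower h.
  exists a; split=> [|c n ac]; first exact: (ha None).
  split; [apply: hh1|apply: hh2].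
    exact: tower_lt_le_trans (ha (Some (n, true))) (tower_ltW ac).
  exact: tower_lt_le_trans (ha (Some (n, false))) (tower_ltW ac).
have [a0 _] := tower_inhabited Ttower.
(* The supremum [c] will exceed [b i.+1], which is [g (b i)], so the equalities in [hg] apply to
   [b i] and [c] in every plank. *)
pose b i := iter i g a0.
have [c hc bc] := tower_cvg_sup Ttower (fun i => (hg (b i)).1 : tower_lt T (b i) (b i.+1)).
have cc : tower_cvg T (fun=> Some (inr c)) (Some (inr c)) by exact: tower_cvg_cst.
have cN : tower_cvg T (fun=> None) None by exact: tower_cvg_cst.
have fcvg (u : nat -> S) p : u i @[i --> \oo] --> p -> f (u i) @[i --> \oo] --> f p.
  by move=> up; apply: continuous_cvg => //; exact: fcont.
have flim (u v : nat -> S) p q : u i @[i --> \oo] --> p -> v i @[i --> \oo] --> q ->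
    (forall i, f (u i) = f (v i)) -> f p = f q.
  move=> /fcvg up /fcvg vq /funext uv; rewrite uv in up.
  exact: cvg_unique up vq.
exists c => n; transitivity (f (pt n (inr c) (Some (inr c)))).
  apply: (@flim (fun i => pt (n + 1) (inr (b i)) None)
                (fun i => pt n (inr c) (Some (inr (b i))))).
  - exact: cvg_plank_pt bc cN.
  - exact: cvg_plank_pt cc bc.
  - by move=> i; rewrite ((hg (b i)).2 c n (hc i.+1)).2.
apply: (@flim (fun i => pt n (inr (b i)) (Some (inr c)))
              (fun i => pt n (inr (b i)) None)).
- exact: cvg_plank_pt bc cc.
- exact: cvg_plank_pt bc cN.
- by move=> i; rewrite ((hg (b i)).2 c n (hc i.+1)).1.
Qed.

(** The edge points [p n] share one value and converge to the two ends as [n] tends to plus and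
    minus infinity. *)
Lemma chain_ends_agree : f (End true) = f (End false).
Proof.
have [c hc] := edges_agree.
pose p n := pt n (inr c) None.
have pS n : f (p (n + 1)%R) = f (p n) by exact: hc.
have pE n : f (p n) = f (p 0%R).
  have pnat (k : nat) : f (p (Posz k)) = f (p 0%R) /\ f (p (- Posz k)%R) = f (p 0%R).
    elim: k => [|k [IH1 IH2]]; first by rewrite oppr0.
    split; first by rewrite (_ : Posz k.+1 = (Posz k + 1)%R) ?pS //; lia.
    by rewrite -pS (_ : (- Posz k.+1 + 1 = - Posz k)%R) //; lia.
  by have [k [->|->]] : exists k : nat, n = Posz k \/ n = (- Posz k)%R;
    [exists `|n|%N; lia|exact: (pnat k).1|exact: (pnat k).2].
have endE b : f (End b) = f (p 0%R).
  have h : (fun i : nat => p (if b then Posz i else - Posz i)%R) i @[i --> \oo] --> End b.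
    apply: cvg_chain_end => N; exists `|N|%N => // i /= Ni.
    by case: b => /=; lia.
  have fb : f (p (if b then Posz i else - Posz i)%R) @[i --> \oo] --> f (End b).
    exact: continuous_cvg (fcont (x := End b)) h.
  by apply: cvg_unique fb _ => //; apply: cvg_near_cst; exact: nearW.
by rewrite !endE.
Qed.

End RealFunctions.

End ChainSpaceTheory.

Theorem theorem5p1 (R : realType) :
  exists S : topologicalType,
    [/\ regular_T1_space S,
        separable_space S,
        sequentially_compact_space S
      & ~ functionally_hausdorff_space R S].
Proof.
have [W [T Ttower]] := maximal_tower_exists.
exists (chain_space T); split.
- by split; [exact: chain_accessible|exact: chain_regular].
- exact: chain_separable.
- exact: chain_sequentially_compact.
- move=> fh; have [//|f fc] := fh (chain_end T true) (chain_end T false).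
  by apply; exact: chain_ends_agree.
Qed.
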